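(* For integers $m,n\ge 1$ with $\gcd(m,n)=1$, and integers $q\ge 1$ and $p\ge q+2$, $$\sum_{k=1}^\infty\frac{k^qH_k}{(mk+n)^p}=\frac1{m^p}\sum_{j=0}^q(-1)^j\binom qj\left(\frac nm\right)^jT\left(\frac nm,\,p-q+j\right).$$
   Context: $H_k = 1+1/2+\cdots+1/k$ is the $k$th harmonic number. $\gamma$ is Euler's constant. $\psi(z)=\Gamma'(z)/\Gamma(z)$ is the digamma function, and $\psi^{(n)}$ denotes its $n$-th derivative, with $\psi^{(0)}=\psi$. For integer $p\ge1$ and $t$ at which $\psi$ is regular (in particular $t=n/m>0$), $$T(t,p)=\frac{(-1)^{p-1}}{2(p-1)!}\left(\psi^{(p)}(t)-2\gamma\,\psi^{(p-1)}(t)-\sum_{k=0}^{p-1}\binom{p-1}{k}\psi^{(k)}(t)\,\psi^{(p-1-k)}(t)\right).$$ *)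

(* Defs.v *)
(* Stdlib real numbers with Coquelicot's total analysis operators. *)
From Stdlib Require Import Reals Arith.
From Coquelicot Require Import Coquelicot.

Open Scope R_scope.

Definition harmonic (k : nat) : R := sum_n_m (fun i : nat => / INR i) 1 k.

Definition euler_gamma : R :=
  real (Lim_seq (fun n : nat => harmonic n - ln (INR n))).

(* Euler's integral of the second kind, improper at both ends.  It converges
   exactly for x > 0; for x <= 0 the value is a meaningless default. *)
Definition Gamma (x : R) : R :=
  RInt_gen (fun u : R => Rpower u (x - 1) * exp (- u))
           (at_right 0) (Rbar_locally p_infty).

Definition digamma (x : R) : R := Derive Gamma x / Gamma x.

Definition polygamma (n : nat) (x : R) : R := Derive_n digamma n x.

(* [Binomial.C] is the binomial coefficient; a bare [C] would be Coquelicot's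
   type of complex numbers.  [sum_f_R0 f N] includes the term [f N].
   Meant for p >= 1 and t > 0. *)
Definition T (t : R) (p : nat) : R :=
  (-1) ^ (p - 1) / (2 * INR (fact (p - 1))) *
  (polygamma p t
   - 2 * euler_gamma * polygamma (p - 1) t
   - sum_f_R0
       (fun k : nat =>
          Binomial.C (p - 1) k * polygamma k t * polygamma (p - 1 - k) t)
       (p - 1)).

(* Main.v *)
(** With [t = n/m], the binomial expansion of [k^q = ((k + t) - t)^q] reduces the
    claim to [sum_k H_k / (k + t)^p = T(t, p)] for [p >= 2].  Since
    [d/dt T(t, p) = - p T(t, p + 1)], termwise differentiation reduces this to
    [p = 2], that is to
    [sum_k H_k/(k+t)^2 = sum_k 1/(k+t)^3 + (psi(t) + gamma) sum_k 1/(k+t)^2];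
    the difference of both sides is 1-periodic in [t] and vanishes at infinity.

    The series for [psi] comes from Euler's integral without differentiating
    under the integral sign.  Integrating the weighted AM-GM inequality
    [x^(1-s) u^s <= (1-s) x + s u] against [u^(x-1) e^(-u)] gives Wendel's
    inequality; with [Gamma (x + 1) = x Gamma x] it squeezes the slopes of
    [ln Gamma] on [[x, y]] between [P x] and [P y], where
    [P x = lim (ln n - sum_{k<n} 1/(x + k))], and [P] is continuous. *)
Require Import Defs.
From Stdlib Require Import Reals Arith Lra Lia.
From Coquelicot Require Import Coquelicot.

Open Scope R_scope.

(** * Euler's integral *)

Lemma ln_le_sub1 (z : R) : 0 < z -> ln z <= z - 1.
Proof.
intros hz; pose proof (exp_ineq1_le (ln z)) as h; rewrite exp_ln in h; lra.
Qed.

Lemma ln_sub_le (a b : R) : 0 < a -> 0 < b -> ln b - ln a <= (b - a) / a.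
Proof.
intros ha hb; rewrite <- ln_div by assumption.
replace ((b - a) / a) with (b / a - 1) by (field; lra).
now apply ln_le_sub1, Rdiv_lt_0_compat.
Qed.

Lemma ln_sub_ge (a b : R) : 0 < a -> 0 < b -> (b - a) / b <= ln b - ln a.
Proof.
intros ha hb; pose proof (ln_sub_le b a hb ha).
replace ((b - a) / b) with (- ((a - b) / b)) by (field; lra); lra.
Qed.

(** Concavity of [ln]: the tangent at the mean [w] bounds both [ln x] and [ln u], and the weighted
    linear terms cancel. *)
Lemma weighted_am_gm (s x u : R) : 0 <= s <= 1 -> 0 < x -> 0 < u ->
  Rpower x (1 - s) * Rpower u s <= (1 - s) * x + s * u.
Proof.
intros hs hx hu; set (w := (1 - s) * x + s * u).
assert (hw : 0 < w).
{ unfold w; destruct (Req_dec s 0) as [-> | hs0]; [lra |].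
  apply Rplus_le_lt_0_compat; [apply Rmult_le_pos; lra |].
  apply Rmult_lt_0_compat; lra. }
unfold Rpower; rewrite <- exp_plus; rewrite <- (exp_ln w hw).
assert (h : (1 - s) * ln x + s * ln u <= ln w);
  [| destruct h as [h | ->]; [left; now apply exp_increasing | lra]].
pose proof (Rmult_le_compat_l (1 - s) _ _ ltac:(lra) (ln_sub_le w x hw hx)).
pose proof (Rmult_le_compat_l s _ _ ltac:(lra) (ln_sub_le w u hw hu)).
assert ((1 - s) * ((x - w) / w) + s * ((u - w) / w) = 0)
  by (unfold w in *; field; lra).
lra.
Qed.

(** The tangent to [ln] at [y] shows that [y ln u - u] is largest at [u = y]. *)
Lemma Rpower_mul_exp_neg_le (y u : R) : 0 < y -> 0 < u ->
  Rpower u y * exp (- u) <= Rpower y y * exp (- y).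
Proof.
intros hy hu; unfold Rpower; rewrite <- !exp_plus.
pose proof (ln_sub_le y u hy hu) as h.
apply (Rmult_le_compat_l y) in h; [| lra].
replace (y * ((u - y) / y)) with (u - y) in h by (field; lra).
assert (h' : y * ln u + - u <= y * ln y + - y) by lra.
destruct h' as [h' | ->]; [left; now apply exp_increasing | lra].
Qed.

(** * Convergence and positivity of Euler's integral *)

Definition gamma_integrand (x u : R) : R := Rpower u (x - 1) * exp (- u).

Lemma Rpower_pos (u y : R) : 0 < Rpower u y.
Proof. apply exp_pos. Qed.

Lemma gamma_integrand_pos (x u : R) : 0 < gamma_integrand x u.
Proof. apply Rmult_lt_0_compat; [apply Rpower_pos | apply exp_pos]. Qed.

Lemma is_derive_Rpower (y u : R) : 0 < u ->
  is_derive (fun v => Rpower v y) u (y * Rpower u (y - 1)).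
Proof. intros; apply is_derive_Reals; now apply derivable_pt_lim_power. Qed.

Lemma continuous_of_ex_derive (f : R -> R) (x : R) :
  ex_derive f x -> continuous f x.
Proof. apply (ex_derive_continuous (K := R_AbsRing) (V := R_NormedModule)). Qed.

Lemma continuous_gamma_integrand (x u : R) : 0 < u ->
  continuous (gamma_integrand x) u.
Proof.
intros hu; apply (continuous_mult (K := R_AbsRing)).
- apply continuous_of_ex_derive.
  eexists; now apply is_derive_Rpower.
- apply continuous_of_ex_derive; auto_derive; easy.
Qed.

Lemma ex_RInt_gamma_integrand (x a b : R) : 0 < a -> 0 < b ->
  ex_RInt (gamma_integrand x) a b.
Proof.
intros ha hb; apply (ex_RInt_continuous (V := R_CompleteNormedModule)).
intros z [hz _]; apply continuous_gamma_integrand.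
revert hz; unfold Rmin; destruct Rle_dec; lra.
Qed.

Lemma Rpower_succ (u y : R) : 0 < u -> Rpower u (y + 1) = Rpower u y * u.
Proof. intros; now rewrite Rpower_plus, Rpower_1. Qed.

(* [u^(x-1) / (1 + u^x)^2] has the bounded antiderivative
   [- 1 / (x (1 + u^x))], so this one bound settles convergence at both ends. *)
Lemma gamma_integrand_le (x : R) : 0 < x -> exists K : R, 0 < K /\
  forall u, 0 < u ->
  gamma_integrand x u <= K * (Rpower u (x - 1) / (1 + Rpower u x) ^ 2).
Proof.
intros hx.
(* The three summands bound the terms of [(1 + 2 u^x + u^(2x)) e^(-u)], each by its maximum. *)
exists (1 + 2 * (Rpower x x * exp (- x))
          + Rpower (2 * x) (2 * x) * exp (- (2 * x))); split.
{ pose proof (Rpower_pos x x); pose proof (exp_pos (-x)).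
  pose proof (Rpower_pos (2*x) (2*x)); pose proof (exp_pos (-(2*x))); nra. }
intros u hu; unfold gamma_integrand.
pose proof (Rpower_pos u x) as h1; pose proof (Rpower_pos u (x - 1)) as h2.
set (K := _ + _ : R).
assert (hK : (1 + Rpower u x) ^ 2 * exp (- u) <= K).
{ pose proof (Rpower_mul_exp_neg_le x u hx hu).
  pose proof (Rpower_mul_exp_neg_le (2 * x) u ltac:(lra) hu) as h.
  replace (2 * x) with (x + x) in h at 1 by ring.
  rewrite Rpower_plus in h.
  assert (exp (- u) <= 1)
    by (rewrite <- exp_0; left; apply exp_increasing; lra).
  unfold K; nra. }
assert (0 < (1 + Rpower u x) ^ 2) by nra.
replace (K * _) with
  (Rpower u (x - 1) * (K / (1 + Rpower u x) ^ 2)) by (field; lra).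
apply Rmult_le_compat_l; [lra |].
apply Rle_div_r; [easy |].
now rewrite Rmult_comm.
Qed.

Lemma RInt_gamma_integrand_bounded (x : R) : 0 < x -> exists M : R,
  forall a b, 0 < a -> a <= b -> RInt (gamma_integrand x) a b <= M.
Proof.
intros hx; destruct (gamma_integrand_le x hx) as [K [hK0 hK]].
(* The antiderivative [G] below increases from [- K / x] at 0 to 0 at infinity. *)
exists (K / x); intros a b ha hab.
set (G := fun u => - (K / x) / (1 + Rpower u x)).
assert (hG : forall u, 0 < u ->
  is_derive G u (K * (Rpower u (x - 1) / (1 + Rpower u x) ^ 2))).
{ intros u hu; unfold G; pose proof (Rpower_pos u x).
  replace (K * (Rpower u (x - 1) / (1 + Rpower u x) ^ 2))
    with ((- (K / x)) * (- (x * Rpower u (x - 1)) / (1 + Rpower u x) ^ 2))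
    by (field; lra).
  apply (is_derive_scal (fun v => / (1 + Rpower v x))).
  apply (is_derive_inv (fun v => 1 + Rpower v x)); [| lra].
  pose proof (is_derive_plus (fun _ => 1) _ u _ _ (is_derive_const 1 u)
                (is_derive_Rpower x u hu)) as h.
  unfold plus, zero in h; simpl in h; now rewrite Rplus_0_l in h. }
assert (hint : is_RInt (fun u => K * (Rpower u (x - 1) / (1 + Rpower u x) ^ 2))
                 a b (G b - G a)).
{ apply (is_RInt_derive (V := R_CompleteNormedModule) G).
  - intros u [hu _]; rewrite Rmin_left in hu by easy; apply hG; lra.
  - intros u [hu _]; rewrite Rmin_left in hu by easy.
    assert (hu' : 0 < u) by lra; pose proof (Rpower_pos u x).
    apply continuous_of_ex_derive.
    unfold Rpower in *; auto_derive; repeat split; try easy; nra. }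
apply Rle_trans with (G b - G a).
- rewrite <- (is_RInt_unique _ _ _ _ hint).
  apply RInt_le; [easy | apply ex_RInt_gamma_integrand; lra
                 | eexists; exact hint |].
  intros u hu; apply hK; lra.
- unfold G; pose proof (Rpower_pos a x); pose proof (Rpower_pos b x).
  assert (0 < K / x) by (now apply Rdiv_lt_0_compat).
  assert (0 < / (1 + Rpower b x)) by (apply Rinv_0_lt_compat; lra).
  assert (/ (1 + Rpower a x) <= 1)
    by (rewrite <- Rinv_1; apply Rinv_le_contravar; lra).
  unfold Rdiv at 1 3; nra.
Qed.

Lemma ball_bounds (x y eps : R) : ball x eps y -> x - eps < y < x + eps.
Proof.
intros h; change (Rabs (y - x) < eps) in h; apply Rabs_def2 in h; lra.
Qed.

(** The integrand is positive, so integrals over [[a, b]] grow with the interval, and the improper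
    integral is their supremum, finite by the uniform bound. *)
Lemma is_RInt_gen_Gamma (x : R) : 0 < x ->
  is_RInt_gen (gamma_integrand x) (at_right 0) (Rbar_locally p_infty) (Gamma x).
Proof.
intros hx; apply (RInt_gen_correct (V := R_CompleteNormedModule) (gamma_integrand x)).
destruct (RInt_gamma_integrand_bounded x hx) as [M hM].
set (E := fun r => exists a b,
  0 < a /\ a <= b /\ r = RInt (gamma_integrand x) a b).
destruct (completeness E) as [L [hL1 hL2]].
{ exists M; intros r (a & b & ha & hab & ->); now apply hM. }
{ exists (RInt (gamma_integrand x) 1 1), 1, 1; repeat split; lra. }
exists L; apply filterlimi_locally; intros eps.
destruct (Classical_Prop.classic
  (exists r, E r /\ L - eps < r)) as [(r & (a & b & ha & hab & ->) & hr) | hn].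
2: { exfalso; assert (L <= L - eps); [| destruct eps; simpl in *; lra].
     apply hL2; intros r hr; apply Rnot_lt_le; intros h; apply hn; eauto. }
apply (Filter_prod _ _ _ (fun a' => 0 < a' < a) (fun b' => b < b')).
- exists (mkposreal a ha); intros y hy hy0; split; [easy |].
  apply ball_bounds in hy; simpl in hy; lra.
- now exists b.
- intros a' b' ha' hb'; simpl.
  exists (RInt (gamma_integrand x) a' b'); split.
  { apply (RInt_correct (V := R_CompleteNormedModule));
      apply ex_RInt_gamma_integrand; lra. }
  assert (RInt (gamma_integrand x) a' b' <= L)
    by (apply hL1; exists a', b'; repeat split; lra).
  assert (RInt (gamma_integrand x) a b <= RInt (gamma_integrand x) a' b').
  { rewrite <- (RInt_Chasles _ a' a b') by (apply ex_RInt_gamma_integrand; lra).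
    rewrite <- (RInt_Chasles _ a b b') by (apply ex_RInt_gamma_integrand; lra).
    unfold plus; simpl.
    assert (0 <= RInt (gamma_integrand x) a' a).
    { apply RInt_ge_0; [lra | apply ex_RInt_gamma_integrand; lra |].
      intros; left; apply gamma_integrand_pos. }
    assert (0 <= RInt (gamma_integrand x) b b').
    { apply RInt_ge_0; [lra | apply ex_RInt_gamma_integrand; lra |].
      intros; left; apply gamma_integrand_pos. }
    lra. }
  apply Rabs_def1; unfold minus, plus, opp; simpl; lra.
Qed.

(** Eventually the ends of integration straddle 1, so that [Rmin a b] is [a] and only positive [u]
    matter. *)
Lemma positive_domain :
  filter_prod (at_right 0) (Rbar_locally p_infty)
    (fun ab : R * R => 0 < fst ab < 1 /\ 1 < snd ab).
Proof.
apply (Filter_prod _ _ _ (fun a => 0 < a < 1) (fun b => 1 < b)).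
- exists (mkposreal 1 Rlt_0_1); intros y hy hy0; split; [easy |].
  apply ball_bounds in hy; simpl in hy; lra.
- now exists 1.
- easy.
Qed.

(** The nonnegative function [g - f] dominates its own norm, so [|lg - lf| <= lg - lf]. *)
Lemma is_RInt_gen_le (f g : R -> R) (lf lg : R) :
  is_RInt_gen f (at_right 0) (Rbar_locally p_infty) lf ->
  is_RInt_gen g (at_right 0) (Rbar_locally p_infty) lg ->
  (forall u, 0 < u -> f u <= g u) -> lf <= lg.
Proof.
intros hf hg hle.
pose proof (is_RInt_gen_minus g f lg lf hg hf) as h.
assert (H : norm (minus lg lf) <= minus lg lf).
{ apply (RInt_gen_norm (fun u => minus (g u) (f u)) (fun u => minus (g u) (f u))
    (Fa := at_right 0) (Fb := Rbar_locally p_infty)); try exact h.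
  - eapply filter_imp; [| exact positive_domain]; intros [a b]; simpl; lra.
  - eapply filter_imp; [| exact positive_domain]; intros [a b]; simpl.
    intros hab u hu; specialize (hle u ltac:(lra)).
    unfold norm, minus, plus, opp; simpl; unfold abs; simpl.
    rewrite Rabs_pos_eq; lra. }
unfold norm, minus, plus, opp in H; simpl in H; unfold abs in H; simpl in H.
pose proof (Rabs_pos (lg + - lf)); lra.
Qed.

(** Every integral over an interval containing [[1, 2]] is at least the positive one over [[1, 2]],
    hence so is the limit. *)
Lemma Gamma_pos (x : R) : 0 < x -> 0 < Gamma x.
Proof.
intros hx; pose proof (is_RInt_gen_Gamma x hx) as h.
assert (h0 : 0 < RInt (gamma_integrand x) 1 2).
{ apply RInt_gt_0; [lra | intros; apply gamma_integrand_pos |].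
  intros; apply continuous_gamma_integrand; lra. }
apply Rlt_le_trans with (1 := h0).
apply Rnot_lt_le; intros hlt.
assert (heps : 0 < RInt (gamma_integrand x) 1 2 - Gamma x) by lra.
pose proof (proj1 (filterlimi_locally _ _) h (mkposreal _ heps)) as hF.
assert (h2 : filter_prod (at_right 0) (Rbar_locally p_infty)
    (fun ab : R * R => 0 < fst ab < 1 /\ 2 < snd ab)).
{ apply (Filter_prod _ _ _ (fun a => 0 < a < 1) (fun b => 2 < b)).
  - exists (mkposreal 1 Rlt_0_1); intros y hy hy0; split; [easy |].
    apply ball_bounds in hy; simpl in hy; lra.
  - now exists 2.
  - easy. }
destruct (filter_ex _ (filter_and _ _ hF h2)) as [[a b] [(z & hz & hb) hab]].
simpl in *.
apply (is_RInt_unique (V := R_CompleteNormedModule)) in hz.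
apply ball_bounds in hb; simpl in hb.
assert (RInt (gamma_integrand x) 1 2 <= z); [| lra].
rewrite <- hz.
rewrite <- (RInt_Chasles _ a 1 b) by (apply ex_RInt_gamma_integrand; lra).
rewrite <- (RInt_Chasles _ 1 2 b) by (apply ex_RInt_gamma_integrand; lra).
unfold plus; simpl.
assert (0 <= RInt (gamma_integrand x) a 1).
{ apply RInt_ge_0; [lra | apply ex_RInt_gamma_integrand; lra |].
  intros; left; apply gamma_integrand_pos. }
assert (0 <= RInt (gamma_integrand x) 2 b).
{ apply RInt_ge_0; [lra | apply ex_RInt_gamma_integrand; lra |].
  intros; left; apply gamma_integrand_pos. }
lra.
Qed.

(** * Functional equation and Wendel's inequality *)

Lemma gamma_boundary_at_0 (x : R) : 0 < x ->
  filterlim (fun u => Rpower u x * exp (- u)) (at_right 0) (locally 0).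
Proof.
intros hx; apply filterlim_locally; intros eps.
exists (mkposreal _ (Rpower_pos eps (/ x))); intros u hu hu0.
apply ball_bounds in hu; simpl in hu.
assert (Rpower u x < eps).
{ replace (eps : R) with (Rpower (Rpower eps (/ x)) x).
  - apply Rlt_Rpower_l; lra.
  - rewrite Rpower_mult, Rinv_l, Rpower_1; [easy | apply cond_pos | lra]. }
assert (exp (- u) < 1) by (rewrite <- exp_0; apply exp_increasing; lra).
pose proof (exp_pos (- u)); pose proof (Rpower_pos u x).
apply Rabs_def1; unfold minus, plus, opp; simpl; nra.
Qed.

Lemma gamma_boundary_at_infty (x : R) : 0 < x ->
  filterlim (fun u => Rpower u x * exp (- u))
    (Rbar_locally p_infty) (locally 0).
Proof.
intros hx; apply filterlim_locally; intros eps.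
(* [K] is the maximum of [u^(x+1) e^(-u)], so [u^x e^(-u) <= K / u]. *)
set (K := Rpower (x + 1) (x + 1) * exp (- (x + 1))).
assert (hK : 0 < K)
  by (apply Rmult_lt_0_compat; [apply Rpower_pos | apply exp_pos]).
pose proof (Rdiv_lt_0_compat _ _ hK (cond_pos eps)) as hM.
exists (K / eps); intros u hu.
pose proof (Rpower_mul_exp_neg_le (x + 1) u ltac:(lra) ltac:(lra)) as h.
fold K in h; rewrite Rpower_succ in h by lra.
pose proof (exp_pos (- u)); pose proof (Rpower_pos u x).
assert (0 < Rpower u x * exp (- u)) by now apply Rmult_lt_0_compat.
assert (K < u * eps) by (apply Rlt_div_l; [apply cond_pos | exact hu]).
apply Rabs_def1; unfold minus, plus, opp; simpl; nra.
Qed.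

(** Integration by parts: [F] has derivative [f], the difference of the two integrands, and vanishes
    at both ends. *)
Lemma Gamma_succ (x : R) : 0 < x -> Gamma (x + 1) = x * Gamma x.
Proof.
intros hx; assert (hx1 : 0 < x + 1) by lra.
set (F := fun u => Rpower u x * exp (- u)).
set (f := fun u => x * gamma_integrand x u - gamma_integrand (x + 1) u).
assert (hF : forall u, 0 < u -> is_derive F u (f u)).
{ intros u hu; unfold F, f, gamma_integrand.
  replace (x + 1 - 1) with x by ring.
  evar_last.
  { apply (is_derive_mult (fun v => Rpower v x) (fun v => exp (- v))).
    - now apply is_derive_Rpower.
    - auto_derive; [easy | reflexivity].
    - intros; apply Rmult_comm. }
  unfold plus, mult; simpl; ring. }
assert (h : is_RInt_gen (Derive F) (at_right 0) (Rbar_locally p_infty) (0 - 0)).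
{ apply is_RInt_gen_Derive.
  - eapply filter_imp; [| exact positive_domain]; intros [a b]; simpl.
    intros hab u hu; rewrite Rmin_left in hu by lra.
    eexists; apply hF; lra.
  - eapply filter_imp; [| exact positive_domain]; intros [a b]; simpl.
    intros hab u hu; rewrite Rmin_left in hu by lra.
    assert (hu0 : 0 < u) by lra.
    apply (continuous_ext_loc _ f).
    + exists (mkposreal u hu0); intros y hy; symmetry.
      apply is_derive_unique, hF.
      apply ball_bounds in hy; simpl in hy; lra.
    + apply (continuous_minus (K := R_AbsRing)
        (fun u => x * gamma_integrand x u) (gamma_integrand (x + 1))).
      * apply (continuous_scal_r (K := R_AbsRing) x (gamma_integrand x)).
        now apply continuous_gamma_integrand.
      * now apply continuous_gamma_integrand.
  - now apply gamma_boundary_at_0.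
  - now apply gamma_boundary_at_infty. }
assert (h2 : is_RInt_gen (Derive F) (at_right 0) (Rbar_locally p_infty)
  (x * Gamma x - Gamma (x + 1))).
{ apply (is_RInt_gen_ext (fun u =>
    minus (scal x (gamma_integrand x u)) (gamma_integrand (x + 1) u))).
  - eapply filter_imp; [| exact positive_domain]; intros [a b]; simpl.
    intros hab u hu; rewrite Rmin_left in hu by lra.
    symmetry; apply is_derive_unique, hF; lra.
  - apply (is_RInt_gen_minus (fun u => scal x (gamma_integrand x u))
             (gamma_integrand (x + 1)) (scal x (Gamma x)) (Gamma (x + 1))).
    + exact (is_RInt_gen_scal _ x _ (is_RInt_gen_Gamma x hx)).
    + exact (is_RInt_gen_Gamma (x + 1) hx1). }
apply (is_RInt_gen_unique (V := R_CompleteNormedModule)) in h.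
apply (is_RInt_gen_unique (V := R_CompleteNormedModule)) in h2.
rewrite h in h2; lra.
Qed.

Lemma Gamma_wendel (x s : R) : 0 < x -> 0 <= s <= 1 ->
  Rpower x (1 - s) * Gamma (x + s) <= x * Gamma x.
Proof.
intros hx hs.
(* The right side is now the integral of [((1 - s) x + s u) u^(x-1) e^(-u)]. *)
replace (x * Gamma x) with ((1 - s) * x * Gamma x + s * Gamma (x + 1))
  by (rewrite Gamma_succ by easy; ring).
assert (hx1 : 0 < x + 1) by lra; assert (hxs : 0 < x + s) by lra.
refine (is_RInt_gen_le _ _ _ _
  (is_RInt_gen_scal _ (Rpower x (1 - s)) _ (is_RInt_gen_Gamma (x + s) hxs))
  (is_RInt_gen_plus _ _ _ _
    (is_RInt_gen_scal _ ((1 - s) * x) _ (is_RInt_gen_Gamma x hx))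
    (is_RInt_gen_scal _ s _ (is_RInt_gen_Gamma (x + 1) hx1))) _).
intros u hu; unfold plus, scal, gamma_integrand; simpl; unfold mult; simpl.
pose proof (weighted_am_gm s x u hs hx hu).
replace (x + s - 1) with (x - 1 + s) by ring.
replace (x + 1 - 1) with (x - 1 + 1) by ring.
rewrite Rpower_plus, Rpower_succ by easy.
pose proof (exp_pos (- u)); pose proof (Rpower_pos u (x - 1)).
assert (0 < Rpower u (x - 1) * exp (- u)) by nra; nra.
Qed.

(** * Series in shifted arguments *)

Lemma ex_series_Rmult_l (x : R) (a : nat -> R) :
  ex_series a -> ex_series (fun k => x * a k).
Proof. exact (ex_series_scal_l (K := R_AbsRing) (V := R_NormedModule) x a). Qed.

Lemma ex_series_Rmult_r (x : R) (a : nat -> R) :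
  ex_series a -> ex_series (fun k => a k * x).
Proof.
intros ha; apply ex_series_ext with (fun k => x * a k);
  [intros; apply Rmult_comm | now apply ex_series_Rmult_l].
Qed.

(** The difference quotient is within [A |y - x|] of [l]. Unlike the limit itself, a quadratic
    remainder can be summed over a series. *)
Lemma is_derive_quadratic (f : R -> R) (x l A delta : R) : 0 < delta ->
  (forall y, Rabs (y - x) < delta ->
     Rabs (f y - f x - l * (y - x)) <= A * (y - x) ^ 2) ->
  is_derive f x l.
Proof.
intros hd h; apply is_derive_Reals; intros eps heps.
(* A positive majorant of [A], whose sign is unknown, to divide by. *)
assert (hA : 0 < Rabs A + 1) by (pose proof (Rabs_pos A); lra).
assert (hr : 0 < Rmin delta (eps / (Rabs A + 1)))
  by (apply Rmin_pos; [easy | now apply Rdiv_lt_0_compat]).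
exists (mkposreal _ hr); intros u hu0 hu; simpl in hu.
pose proof (Rmin_l delta (eps / (Rabs A + 1))).
pose proof (Rmin_r delta (eps / (Rabs A + 1))).
specialize (h (x + u)); replace (x + u - x) with u in h by ring.
specialize (h ltac:(lra)).
assert (hu' : 0 < Rabs u) by now apply Rabs_pos_lt.
replace ((f (x + u) - f x) / u - l) with ((f (x + u) - f x - l * u) / u)
  by (field; easy).
rewrite Rabs_div by easy; apply Rlt_div_l; [easy |].
assert (hu2 : Rabs u * (Rabs A + 1) < eps) by (apply Rlt_div_r; lra).
rewrite <- (pow2_abs u) in h; pose proof (Rle_abs A); nra.
Qed.

(** Termwise quadratic remainders with summable constants [M k] add up to a quadratic remainder for
    the sum. *)
Lemma is_derive_Series (f : nat -> R -> R) (g M : nat -> R) (x delta : R) :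
  0 < delta ->
  (forall y, Rabs (y - x) < delta -> ex_series (fun k => f k y)) ->
  ex_series g -> ex_series M ->
  (forall k y, Rabs (y - x) < delta ->
     Rabs (f k y - f k x - g k * (y - x)) <= M k * (y - x) ^ 2) ->
  is_derive (fun y => Series (fun k => f k y)) x (Series g).
Proof.
intros hd hf hg hM h.
apply (is_derive_quadratic _ _ _ (Series M) delta hd); intros y hy.
assert (hfx : ex_series (fun k => f k x))
  by (apply hf; rewrite Rminus_diag, Rabs_R0; easy).
assert (hgy : ex_series (fun k => (y - x) * g k))
  by exact (ex_series_Rmult_l (y - x) g hg).
assert (hMy : ex_series (fun k => (y - x) ^ 2 * M k))
  by exact (ex_series_Rmult_l ((y - x) ^ 2) M hM).
specialize (hf y hy).
rewrite (Rmult_comm (Series g)), (Rmult_comm (Series M)).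
rewrite <- !Series_scal_l, <- !Series_minus; try easy.
2: exact (ex_series_minus (V := R_NormedModule) _ _ hf hfx).
assert (hb : forall k, norm (f k y - f k x - (y - x) * g k)
                       <= (y - x) ^ 2 * M k).
{ intros k; rewrite (Rmult_comm (y - x)), (Rmult_comm ((y - x) ^ 2)).
  now apply h. }
eapply Rle_trans.
- apply Series_Rabs.
  apply (ex_series_le (V := R_CompleteNormedModule)) with (2 := hMy).
  intros k; change (norm (Rabs ?u)) with (Rabs (Rabs u)).
  rewrite Rabs_Rabsolu; apply hb.
- apply Series_le; [| easy]; intros k; split; [apply Rabs_pos | apply hb].
Qed.

(** First-order Taylor remainder of [1 / z^p] at [a]. Dividing it by [b] gives the remainder for
    [S p] up to an explicit nonnegative term, so both bounds follow by induction. *)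
Lemma inv_pow_taylor (p : nat) (a b r : R) : 0 < r -> r <= a -> r <= b ->
  0 <= / b ^ p - / a ^ p + INR p * (b - a) / a ^ S p
    <= INR p * INR (S p) * (b - a) ^ 2 / r ^ (p + 2).
Proof.
intros hr ha hb.
assert (hA : 0 < / a <= / r)
  by (split; [apply Rinv_0_lt_compat; lra | apply Rinv_le_contravar; lra]).
assert (hB : 0 < / b <= / r)
  by (split; [apply Rinv_0_lt_compat; lra | apply Rinv_le_contravar; lra]).
induction p as [| p [IH1 IH2]].
{ unfold Rdiv; simpl; rewrite !Rmult_0_l, Rinv_1; lra. }
set (h := b - a) in *.
set (X := / b ^ p - / a ^ p + INR p * h / a ^ S p) in *.
assert (pa : 0 < a ^ p) by (apply pow_lt; lra).
assert (pb : 0 < b ^ p) by (apply pow_lt; lra).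
replace (/ b ^ S p - / a ^ S p + INR (S p) * h / a ^ S (S p))
  with (/ b * X + INR (S p) * h ^ 2 * (/ a) ^ (p + 2) * / b).
2: { unfold X, h; rewrite S_INR, pow_add, pow_inv; simpl; field; lra. }
assert (0 <= INR p) by apply pos_INR.
assert (e : / r ^ (p + 2) = (/ r) ^ (p + 2)) by now rewrite pow_inv.
assert (e' : / r ^ (S p + 2) = / r * (/ r) ^ (p + 2))
  by (rewrite <- pow_inv; easy).
assert (hp : 0 <= (/ a) ^ (p + 2) <= (/ r) ^ (p + 2))
  by (split; [apply pow_le; lra | apply pow_incr; lra]).
assert (h2 : 0 <= h ^ 2) by apply pow2_ge_0.
unfold Rdiv in *; rewrite e in IH2; rewrite e', !S_INR in *.
clearbody X; set (P := INR p) in *; set (q := h ^ 2) in *.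
set (A := (/ a) ^ (p + 2)) in *; set (K := (/ r) ^ (p + 2)) in *.
clearbody P q A K.
split.
- apply Rplus_le_le_0_compat; [nra |].
  repeat apply Rmult_le_pos; lra.
- assert (/ b * X <= / r * (P * (P + 1) * q * K))
    by (apply Rmult_le_compat; lra).
  assert ((P + 1) * q * A * / b <= (P + 1) * q * K * / r).
  { apply Rmult_le_compat; try lra.
    - repeat apply Rmult_le_pos; lra.
    - apply Rmult_le_compat_l; [apply Rmult_le_pos |]; lra. }
  assert (0 <= (P + 1) * q * K * / r)
    by (repeat apply Rmult_le_pos; lra).
  nra.
Qed.

(** * Harmonic numbers and a dominating series *)

Lemma harmonic_0 : harmonic 0 = 0.
Proof. unfold harmonic; now rewrite sum_n_m_zero by lia. Qed.

Lemma harmonic_S (k : nat) : harmonic (S k) = harmonic k + / INR (S k).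
Proof. unfold harmonic; now rewrite sum_n_Sm by lia. Qed.

Lemma inv_INR_S_pos (k : nat) : 0 < / INR (S k).
Proof. apply Rinv_0_lt_compat, lt_0_INR; lia. Qed.

Lemma harmonic_le (k l : nat) : (k <= l)%nat -> harmonic k <= harmonic l.
Proof.
induction 1 as [| l _ IH]; [lra |].
rewrite harmonic_S; pose proof (inv_INR_S_pos l); lra.
Qed.

Lemma harmonic_ge_0 (k : nat) : 0 <= harmonic k.
Proof. rewrite <- harmonic_0; apply harmonic_le; lia. Qed.

Lemma Series_nonneg (a : nat -> R) :
  (forall k, 0 <= a k) -> ex_series a -> 0 <= Series a.
Proof.
intros h0 ha; rewrite <- (Rmult_0_l (Series a)), <- Series_scal_l.
apply Series_le; [| easy]; intros k; specialize (h0 k); lra.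
Qed.

Lemma ex_series_nonneg_bounded (a : nat -> R) (B : R) :
  (forall k, 0 <= a k) -> (forall n, sum_f_R0 a n <= B) -> ex_series a.
Proof.
intros ha hB; apply ex_finite_lim_seq_incr with (M := B);
  intros n; rewrite !sum_n_Reals; [| apply hB].
rewrite tech5; specialize (ha (S n)); lra.
Qed.

(* [2 (H_k + 2) / (k + 1)] decreases by [2 (H_k + 1) / ((k + 1) (k + 2))]. *)
Lemma ex_series_harmonic_S :
  ex_series (fun k => (harmonic k + 1) / INR (S k) ^ 2).
Proof.
set (u := fun k => 2 * (harmonic k + 2) / INR (S k)).
assert (hS : forall k, 0 < INR (S k)) by (intros; apply lt_0_INR; lia).
assert (hu : forall k,
  (harmonic k + 1) / INR (S k) ^ 2 <= u k - u (S k)).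
{ intros k; unfold u; rewrite harmonic_S.
  pose proof (hS k); pose proof (harmonic_ge_0 k).
  rewrite (S_INR (S k)); set (x := INR (S k)) in *.
  assert (1 <= x) by (unfold x; rewrite S_INR; pose proof (pos_INR k); lra).
  replace (2 * (harmonic k + 2) / x - 2 * (harmonic k + / x + 2) / (x + 1))
    with ((harmonic k + 1) / x ^ 2 * (2 * x / (x + 1))) by (field; lra).
  assert (0 <= (harmonic k + 1) / x ^ 2)
    by (apply Rdiv_le_0_compat; [lra | nra]).
  assert (1 <= 2 * x / (x + 1)) by (apply Rle_div_r; lra).
  nra. }
apply ex_series_nonneg_bounded with (B := u 0%nat).
- intros k; pose proof (harmonic_ge_0 k); pose proof (hS k).
  apply Rdiv_le_0_compat; [lra | nra].
- intros n; apply Rle_trans with (u 0%nat - u (S n)).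
  + induction n as [| n IH]; [apply hu |].
    rewrite tech5; specialize (hu (S n)); lra.
  + assert (0 <= u (S n)); [| lra]; unfold u.
    pose proof (harmonic_ge_0 (S n)).
    apply Rdiv_le_0_compat; [lra | apply hS].
Qed.

(** Serves to compare every series in [k + t] with one fixed series in [k + 1]. *)
Lemma shift_ge (t : R) (k : nat) : 0 < t ->
  Rmin t 1 * INR (S k) <= INR k + t.
Proof.
intros ht; rewrite S_INR; pose proof (pos_INR k).
pose proof (Rmin_l t 1); pose proof (Rmin_r t 1).
assert (Rmin t 1 * INR k <= 1 * INR k) by (now apply Rmult_le_compat_r).
lra.
Qed.

(** For [p >= 2] and [t > 0], the constant [c = 1] gives the Hurwitz zeta value at [(p, t)]. *)
Definition shift_series (c : nat -> R) (p : nat) (t : R) : R :=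
  Series (fun k => c k / (INR k + t) ^ p).

(** The added 1 admits the coefficients [1] and [harmonic k + 1] besides [harmonic k], although
    [harmonic 0] is 0. *)
Definition harmonic_dominated (c : nat -> R) : Prop :=
  forall k, 0 <= c k <= harmonic k + 1.

Lemma shift_pos (k : nat) (t : R) : 0 < t -> 0 < INR k + t.
Proof. intros; pose proof (pos_INR k); lra. Qed.

Lemma ex_shift_series (c : nat -> R) (p : nat) (t : R) :
  harmonic_dominated c -> (2 <= p)%nat -> 0 < t ->
  ex_series (fun k => c k / (INR k + t) ^ p).
Proof.
intros hc hp ht.
set (m := Rmin t 1); assert (hm : 0 < m) by (apply Rmin_pos; lra).
(* Of the [p] factors [k + t], two are at least [m (k + 1)] and the other [p - 2] at least [t]. *)
apply (ex_series_le (V := R_CompleteNormedModule)) with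
  (fun k => / (m ^ 2 * t ^ (p - 2)) * ((harmonic k + 1) / INR (S k) ^ 2)).
2: apply (ex_series_Rmult_l
            (/ (m ^ 2 * t ^ (p - 2)))), ex_series_harmonic_S.
intros k; pose proof (shift_pos k t ht) as hk.
assert (hpk : 0 < (INR k + t) ^ p) by now apply pow_lt.
assert (hS : 0 < INR (S k)) by (apply lt_0_INR; lia).
destruct (hc k) as [hc1 hc2].
change (norm ?u) with (Rabs u); rewrite Rabs_pos_eq
  by (apply Rdiv_le_0_compat; lra).
assert (htp : 0 < t ^ (p - 2)) by now apply pow_lt.
replace (/ (m ^ 2 * t ^ (p - 2)) * ((harmonic k + 1) / INR (S k) ^ 2))
  with ((harmonic k + 1) / ((m * INR (S k)) ^ 2 * t ^ (p - 2)))
  by (field; lra).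
apply Rmult_le_compat; [easy | left; now apply Rinv_0_lt_compat | easy |].
assert (hmS : 0 < m * INR (S k)) by now apply Rmult_lt_0_compat.
apply Rinv_le_contravar.
- apply Rmult_lt_0_compat; [now apply pow_lt | easy].
- replace p with (2 + (p - 2))%nat at 2 by lia; rewrite pow_add.
  apply Rmult_le_compat; try (apply pow_le; lra).
  + apply pow_incr; split; [lra |]; now apply shift_ge.
  + apply pow_incr; pose proof (pos_INR k); lra.
Qed.

(** The radius [x / 2] keeps [k + x] and [k + y] above [k + x / 2], so the constant is independent
    of [y] and summable after multiplication by dominated coefficients. *)
Lemma shift_remainder (p k : nat) (x y : R) :
  0 < x -> Rabs (y - x) < x / 2 ->
  Rabs (/ (INR k + y) ^ p - / (INR k + x) ^ p
        + INR p / (INR k + x) ^ S p * (y - x))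
  <= INR p * INR (S p) / (INR k + x / 2) ^ (p + 2) * (y - x) ^ 2.
Proof.
intros hx hy; apply Rabs_def2 in hy; pose proof (pos_INR k).
destruct (inv_pow_taylor p (INR k + x) (INR k + y) (INR k + x / 2))
  as [h1 h2]; try lra.
replace (INR k + y - (INR k + x)) with (y - x) in * by ring.
replace (INR p / (INR k + x) ^ S p * (y - x))
  with (INR p * (y - x) / (INR k + x) ^ S p) by (unfold Rdiv; ring).
rewrite Rabs_pos_eq by easy; unfold Rdiv in *; lra.
Qed.

Lemma is_derive_shift_series (c : nat -> R) (p : nat) (x : R) :
  harmonic_dominated c -> (2 <= p)%nat -> 0 < x ->
  is_derive (shift_series c p) x (- INR p * shift_series c (S p) x).
Proof.
intros hc hp hx; unfold shift_series; rewrite <- Series_scal_l.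
apply (is_derive_Series (fun k y => c k / (INR k + y) ^ p) _
  (fun k => INR p * INR (S p) * (c k / (INR k + x / 2) ^ (p + 2))) x (x / 2)).
- lra.
- intros y hy; apply Rabs_def2 in hy; apply ex_shift_series; try easy; lra.
- apply (ex_series_Rmult_l (- INR p)).
  apply ex_shift_series; try easy; lia.
- apply (ex_series_Rmult_l (INR p * INR (S p))).
  apply ex_shift_series; try easy; [lia | lra].
- intros k y hy; pose proof (shift_remainder p k x y hx hy) as h.
  destruct (hc k) as [hc1 _].
  apply (Rmult_le_compat_l (c k)) in h; [| easy].
  rewrite <- (Rabs_pos_eq (c k)) in h at 1 by easy.
  rewrite <- Rabs_mult in h.
  unfold Rdiv in *.
  match goal with |- Rabs ?u <= ?v =>
    match type of h with Rabs ?u' <= ?v' =>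
      replace u with u' by ring; replace v with v' by ring; exact h
    end end.
Qed.

(** The classical series for [psi(t) + gamma]. *)
Definition psi_series (t : R) : R :=
  Series (fun k => / INR (S k) - / (INR k + t)).

Lemma one_dominated : harmonic_dominated (fun _ => 1).
Proof. intros k; pose proof (harmonic_ge_0 k); lra. Qed.

Lemma harmonic_self_dominated : harmonic_dominated harmonic.
Proof. intros k; pose proof (harmonic_ge_0 k); lra. Qed.

Lemma ex_psi_series (t : R) : 0 < t ->
  ex_series (fun k => / INR (S k) - / (INR k + t)).
Proof.
intros ht; set (m := Rmin t 1); assert (hm : 0 < m) by (apply Rmin_pos; lra).
apply (ex_series_le (V := R_CompleteNormedModule)) with
  (fun k => Rabs (t - 1) / m * ((harmonic k + 1) / INR (S k) ^ 2)).
2: apply (ex_series_Rmult_l (Rabs (t - 1) / m)),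
     ex_series_harmonic_S.
intros k; pose proof (shift_pos k t ht) as hk.
assert (hS : 0 < INR (S k)) by (apply lt_0_INR; lia).
pose proof (shift_ge t k ht) as hge; fold m in hge.
assert (hmS : 0 < m * INR (S k)) by now apply Rmult_lt_0_compat.
change (norm ?u) with (Rabs u).
replace (/ INR (S k) - / (INR k + t))
  with ((t - 1) * (/ INR (S k) * / (INR k + t)))
  by (rewrite S_INR in *; field; lra).
rewrite Rabs_mult, (Rabs_pos_eq (/ INR (S k) * / (INR k + t)))
  by (apply Rmult_le_pos; left; apply Rinv_0_lt_compat; lra).
replace (Rabs (t - 1) / m * ((harmonic k + 1) / INR (S k) ^ 2))
  with (Rabs (t - 1) * ((harmonic k + 1)
          * (/ INR (S k) * / (m * INR (S k))))) by (field; lra).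
apply Rmult_le_compat_l; [apply Rabs_pos |].
assert (/ (INR k + t) <= / (m * INR (S k))) by (apply Rinv_le_contravar; lra).
pose proof (Rinv_0_lt_compat _ hS); pose proof (Rinv_0_lt_compat _ hmS).
assert (/ INR (S k) * / (INR k + t) <= / INR (S k) * / (m * INR (S k)))
  by (apply Rmult_le_compat_l; [left |]; assumption).
set (X := / INR (S k) * / (INR k + t)) in *.
set (Y := / INR (S k) * / (m * INR (S k))) in *.
assert (0 <= Y) by (apply Rmult_le_pos; left; assumption).
pose proof (harmonic_ge_0 k); nra.
Qed.

Lemma is_derive_psi_series (x : R) : 0 < x ->
  is_derive psi_series x (shift_series (fun _ => 1) 2 x).
Proof.
intros hx; unfold shift_series.
apply (is_derive_Series (fun k y => / INR (S k) - / (INR k + y)) _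
  (fun k => 2 * (1 / (INR k + x / 2) ^ 3)) x (x / 2)).
- lra.
- intros y hy; apply Rabs_def2 in hy; apply ex_psi_series; lra.
- apply ex_shift_series; [apply one_dominated | lia | easy].
- apply (ex_series_Rmult_l 2).
  apply (ex_shift_series (fun _ => 1)); [apply one_dominated | lia | lra].
(* The constants [/ INR (S k)] cancel in the difference, and [1 / (k + y)] enters with a minus sign,
   hence the negation. *)
- intros k y hy; pose proof (shift_remainder 1 k x y hx hy) as h.
  rewrite <- Rabs_Ropp in h; simpl INR in h; change (1 + 2)%nat with 3%nat in h.
  rewrite !pow_1 in h.
  match goal with |- Rabs ?u <= ?v =>
    match type of h with Rabs ?u' <= ?v' =>
      replace u with u' by (unfold Rdiv; ring);
      replace v with v' by (unfold Rdiv; ring); exact h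
    end end.
Qed.

(** * Recurrences under a unit shift and the case p = 2 *)

Lemma is_lim_seq_inv_shift (t : R) :
  is_lim_seq (fun n => / (INR n + t)) 0.
Proof.
replace (Finite 0) with (Rbar_inv p_infty) by easy.
apply is_lim_seq_inv; [| easy].
eapply is_lim_seq_plus; [apply is_lim_seq_INR | apply is_lim_seq_const | easy].
Qed.

(** The difference of the two series telescopes. *)
Lemma psi_series_succ (t : R) : 0 < t -> psi_series (t + 1) = psi_series t + / t.
Proof.
intros ht; unfold psi_series.
assert (h : is_series (fun k => / (INR k + t) - / (INR k + (t + 1))) (/ t)).
{ change (is_lim_seq (sum_n (fun k => / (INR k + t) - / (INR k + (t + 1))))
            (/ t)).
  apply is_lim_seq_ext with (fun n => / t - / (INR n + (t + 1))).
  - intros n; rewrite sum_n_Reals; induction n as [| n IH].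
    + simpl; now rewrite !Rplus_0_l.
    + rewrite tech5, <- IH, S_INR.
      replace (INR n + 1 + t) with (INR n + (t + 1)) by ring; ring.
  - replace (/ t) with (/ t - 0) at 1 by ring.
    apply is_lim_seq_minus'; [apply is_lim_seq_const |].
    apply is_lim_seq_inv_shift. }
rewrite <- (is_series_unique _ _ h), <- Series_plus.
- apply Series_ext; intros k; lra.
- now apply ex_psi_series.
- now exists (/ t).
Qed.

Lemma shift_series_succ (c : nat -> R) (p : nat) (t : R) :
  harmonic_dominated c -> (2 <= p)%nat -> 0 < t ->
  shift_series c p t = c 0%nat / t ^ p + shift_series (fun k => c (S k)) p (t + 1).
Proof.
intros hc hp ht; unfold shift_series.
rewrite Series_incr_1 by now apply ex_shift_series.
f_equal; [now rewrite Rplus_0_l |].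
apply Series_ext; intros k; rewrite S_INR; f_equal; f_equal; ring.
Qed.

(** Shifting the index turns [H_k] into [H_k + 1/(k+1)]. With [a = k + 1] and [b = a + t], the extra
    term splits by partial fractions: [1/(a b^2) = (1/a - 1/b)/t^2 - 1/(t b^2)]. *)
Lemma harmonic_series_succ (t : R) : 0 < t ->
  shift_series harmonic 2 t = shift_series harmonic 2 (t + 1)
    + psi_series (t + 1) / t ^ 2 - shift_series (fun _ => 1) 2 (t + 1) / t.
Proof.
intros ht.
rewrite (shift_series_succ harmonic) by (auto using harmonic_self_dominated).
rewrite harmonic_0; unfold Rdiv at 1; rewrite Rmult_0_l, Rplus_0_l.
change (?a + ?b / t ^ 2 - ?c / t) with (a + b * / t ^ 2 - c * / t).
unfold shift_series, psi_series.
rewrite <- !Series_scal_r.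
assert (h1 : ex_series (fun k => harmonic k / (INR k + (t + 1)) ^ 2))
  by (apply ex_shift_series; [apply harmonic_self_dominated | lia | lra]).
assert (h2 : ex_series (fun k =>
  (/ INR (S k) - / (INR k + (t + 1))) * / t ^ 2)).
{ apply (ex_series_Rmult_r (/ t ^ 2)
    (fun k => / INR (S k) - / (INR k + (t + 1)))), ex_psi_series; lra. }
rewrite <- Series_plus by easy; rewrite <- Series_minus.
- apply Series_ext; intros k; rewrite harmonic_S, S_INR.
  pose proof (pos_INR k); field; lra.
- exact (ex_series_plus (V := R_NormedModule) _ _ h1 h2).
- apply (ex_series_Rmult_r (/ t)
    (fun k => 1 / (INR k + (t + 1)) ^ 2)).
  apply (ex_shift_series (fun _ => 1)); [apply one_dominated | lia | lra].
Qed.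

Lemma is_lim_seq_tail (a : nat -> R) : ex_series a ->
  is_lim_seq (fun n => Series (fun k => a (n + k)%nat)) 0.
Proof.
intros ha; apply is_lim_seq_incr_1.
apply is_lim_seq_ext with (fun n => Series a - sum_n a n).
- intros n; rewrite (Series_incr_n a (S n)) by (easy || lia).
  rewrite sum_n_Reals; simpl pred; lra.
- replace 0 with (Series a - Series a) by ring.
  apply is_lim_seq_minus'; [apply is_lim_seq_const |].
  exact (Series_correct a ha).
Qed.

(** Each unit step adds [1 / (n + t)], at most a constant times [1 / (n + 1)], so growth is no
    faster than that of [harmonic n]. *)
Lemma psi_series_growth (t : R) (n : nat) : 0 < t ->
  Rabs (psi_series (INR n + t))
    <= (Rabs (psi_series t) + / Rmin t 1) * (1 + harmonic n).
Proof.
intros ht; assert (hm : 0 < Rmin t 1) by (apply Rmin_pos; lra).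
pose proof (Rinv_0_lt_compat _ hm); pose proof (Rabs_pos (psi_series t)).
apply Rle_trans with (Rabs (psi_series t) + / Rmin t 1 * harmonic n).
2: { pose proof (harmonic_ge_0 n); nra. }
induction n as [| n IH].
{ rewrite harmonic_0; simpl; rewrite Rplus_0_l; lra. }
pose proof (shift_pos n t ht) as hn; pose proof (shift_ge t n ht).
replace (INR (S n) + t) with (INR n + t + 1) by (rewrite S_INR; ring).
rewrite psi_series_succ, harmonic_S by easy.
assert (hS : 0 < INR (S n)) by (apply lt_0_INR; lia).
assert (/ (INR n + t) <= / Rmin t 1 * / INR (S n)).
{ rewrite <- Rinv_mult; apply Rinv_le_contravar; [| easy].
  now apply Rmult_lt_0_compat. }
pose proof (Rinv_0_lt_compat _ hn) as hi.
pose proof (Rabs_triang (psi_series (INR n + t)) (/ (INR n + t))).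
rewrite (Rabs_pos_eq (/ (INR n + t))) in * by lra.
lra.
Qed.

(** The series at [n + t] is compared with the tail of one fixed convergent series. The weight [b]
    will be [1] or [1 + harmonic n]; the latter absorbs the growth of [psi_series]. *)
Lemma shift_series_le_tail (c : nat -> R) (t : R) (b : R) (n : nat) :
  harmonic_dominated c -> 0 < t -> 0 <= b ->
  (forall k, b * c k <= harmonic (n + k) + 1) ->
  0 <= b * shift_series c 2 (INR n + t) <=
  Series (fun k => (harmonic (n + k) + 1) / (INR (n + k) + t) ^ 2).
Proof.
intros hc ht hb hle.
assert (hs : forall k, 0 < (INR (n + k) + t) ^ 2)
  by (intros k; apply pow_lt, shift_pos, ht).
assert (e : b * shift_series c 2 (INR n + t)
            = Series (fun k => b * c k / (INR (n + k) + t) ^ 2)).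
{ unfold shift_series; rewrite <- Series_scal_l; apply Series_ext; intros k.
  rewrite plus_INR; unfold Rdiv; rewrite Rmult_assoc.
  do 4 f_equal; ring. }
rewrite e; split.
- rewrite <- e; apply Rmult_le_pos; [easy |].
  apply Series_nonneg.
  + intros k; pose proof (hc k); apply Rdiv_le_0_compat; [lra |].
    apply pow_lt, shift_pos; pose proof (pos_INR n); lra.
  + apply ex_shift_series; [easy | lia |]; pose proof (pos_INR n); lra.
- apply Series_le.
  + intros k; specialize (hs k); split.
    * apply Rdiv_le_0_compat; [| easy]; pose proof (hc k); nra.
    * apply Rmult_le_compat_r; [left; now apply Rinv_0_lt_compat | apply hle].
  + apply (ex_series_incr_n (V := R_NormedModule)
      (fun k => (harmonic k + 1) / (INR k + t) ^ 2)).
    apply (ex_shift_series (fun k => harmonic k + 1)); [| lia | easy].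
    intros k; pose proof (harmonic_ge_0 k); lra.
Qed.

Lemma shift_series_3_le (t : R) : 0 < t ->
  0 <= shift_series (fun _ => 1) 3 t <= / t * shift_series (fun _ => 1) 2 t.
Proof.
intros ht; unfold shift_series.
assert (h : forall k, 0 <= 1 / (INR k + t) ^ 3 <= / t * (1 / (INR k + t) ^ 2)).
{ intros k; pose proof (shift_pos k t ht) as hk; pose proof (pos_INR k).
  assert (0 < (INR k + t) ^ 2) by now apply pow_lt.
  assert (0 < (INR k + t) ^ 3) by now apply pow_lt.
  split; [apply Rdiv_le_0_compat; lra |].
  replace (1 / (INR k + t) ^ 3) with (/ (INR k + t) * (1 / (INR k + t) ^ 2))
    by (field; lra).
  apply Rmult_le_compat_r; [apply Rdiv_le_0_compat; lra |].
  apply Rinv_le_contravar; lra. }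
split.
- apply Series_nonneg; [intros k; apply h |].
  apply (ex_shift_series (fun _ => 1)); [apply one_dominated | lia | easy].
- rewrite <- Series_scal_l; apply Series_le; [exact h |].
  apply (ex_series_Rmult_l (/ t)
    (fun k => 1 / (INR k + t) ^ 2)).
  apply (ex_shift_series (fun _ => 1)); [apply one_dominated | lia | easy].
Qed.

(* The difference of the two sides is 1-periodic in [t] and tends to 0 along
   [t + n]. *)
Lemma harmonic_series_2 (t : R) : 0 < t ->
  shift_series harmonic 2 t =
    shift_series (fun _ => 1) 3 t
    + psi_series t * shift_series (fun _ => 1) 2 t.
Proof.
intros ht.
set (D := fun x => shift_series harmonic 2 x - (shift_series (fun _ => 1) 3 x
    + psi_series x * shift_series (fun _ => 1) 2 x)).
assert (hper : forall x, 0 < x -> D x = D (x + 1)).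
{ intros x hx; unfold D.
  rewrite harmonic_series_succ by easy.
  rewrite (shift_series_succ (fun _ => 1) 3 x), (shift_series_succ (fun _ => 1) 2 x)
    by (apply one_dominated || lia || lra).
  rewrite psi_series_succ by easy; field; lra. }
assert (hN : forall n, D (INR n + t) = D t).
{ induction n as [| n IH]; [f_equal; simpl; ring |].
  rewrite <- IH, (hper (INR n + t)) by now apply shift_pos.
  f_equal; rewrite S_INR; ring. }
set (tail := fun n =>
  Series (fun k => (harmonic (n + k) + 1) / (INR (n + k) + t) ^ 2)).
assert (htail : is_lim_seq tail 0).
{ apply (is_lim_seq_tail (fun k => (harmonic k + 1) / (INR k + t) ^ 2)).
  apply (ex_shift_series (fun k => harmonic k + 1)); [| lia | easy].
  intros k; pose proof (harmonic_ge_0 k); lra. }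
set (A := Rabs (psi_series t) + / Rmin t 1).
(* The summands of [B] bound, in units of [tail n], the three parts of [D]: the harmonic series, the
   cubic series and the product with [psi_series]. *)
set (B := 1 + / t + A).
assert (hB : forall n, Rabs (D t) <= B * tail n).
{ intros n; rewrite <- (hN n); unfold D.
  pose proof (shift_pos n t ht) as hn.
  assert (h1 : 0 <= 1 * shift_series harmonic 2 (INR n + t) <= tail n).
  { apply shift_series_le_tail; try easy; [apply harmonic_self_dominated | lra |].
    intros k; pose proof (harmonic_le k (n + k) ltac:(lia)); lra. }
  assert (h2 : 0 <= (1 + harmonic n) * shift_series (fun _ => 1) 2 (INR n + t)
               <= tail n).
  { pose proof (harmonic_ge_0 n).
    apply shift_series_le_tail; try easy; [apply one_dominated | lra |].
    intros k; pose proof (harmonic_le n (n + k) ltac:(lia)); lra. }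
  pose proof (shift_series_3_le (INR n + t) hn) as h3.
  pose proof (psi_series_growth t n ht) as h4; fold A in h4.
  pose proof (harmonic_ge_0 n).
  set (Z2 := shift_series (fun _ => 1) 2 (INR n + t)) in *.
  assert (hZ : 0 <= Z2).
  { assert (0 < 1 + harmonic n) by lra.
    apply Rmult_le_reg_l with (1 + harmonic n); [easy |].
    rewrite Rmult_0_r; lra. }
  assert (h5 : Rabs (psi_series (INR n + t) * Z2) <= A * tail n).
  { rewrite Rabs_mult, (Rabs_pos_eq Z2) by easy.
    apply Rle_trans with (A * (1 + harmonic n) * Z2).
    - now apply Rmult_le_compat_r.
    - rewrite Rmult_assoc; apply Rmult_le_compat_l; [| lra].
      unfold A; pose proof (Rabs_pos (psi_series t)).
      assert (0 < / Rmin t 1) by (apply Rinv_0_lt_compat, Rmin_pos; lra); lra. }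
  assert (h6 : / (INR n + t) * Z2 <= / t * tail n).
  { apply Rmult_le_compat; try easy.
    - left; now apply Rinv_0_lt_compat.
    - apply Rinv_le_contravar; [easy |]; pose proof (pos_INR n); lra.
    - nra. }
  apply Rabs_le; apply Rabs_le_between in h5; unfold B; lra. }
assert (h0 : Rabs (D t) <= 0).
{ assert (hl : is_lim_seq (fun n => B * tail n) (B * 0))
    by exact (is_lim_seq_scal_l _ B _ htail).
  rewrite Rmult_0_r in hl.
  exact (is_lim_seq_le _ _ _ _ hB (is_lim_seq_const _) hl). }
pose proof (Rabs_pos (D t)).
assert (hD : D t = 0) by (apply Rabs_eq_0; lra).
unfold D in hD; lra.
Qed.

(** * The digamma function and its derivatives *)

Lemma ln_le_harmonic (n : nat) : ln (INR (S n)) <= harmonic n.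
Proof.
induction n as [| n IH]; [rewrite harmonic_0; simpl; rewrite ln_1; lra |].
rewrite harmonic_S.
assert (h1 : 0 < INR (S n)) by (apply lt_0_INR; lia).
assert (h2 : 0 < INR (S (S n))) by (apply lt_0_INR; lia).
pose proof (ln_sub_le _ _ h1 h2) as h.
rewrite (S_INR (S n)) in h at 2.
replace (INR (S n) + 1 - INR (S n)) with 1 in h by ring.
unfold Rdiv in h; lra.
Qed.

(** The sequence decreases and is bounded below by 0, so the limit is finite and [real] returns it
    unchanged. Starting at [S n] avoids [ln 0]. *)
Lemma is_lim_seq_euler_gamma :
  is_lim_seq (fun n => harmonic (S n) - ln (INR (S n))) euler_gamma.
Proof.
unfold euler_gamma; rewrite <- Lim_seq_incr_1; apply Lim_seq_correct'.
apply ex_finite_lim_seq_decr with (M := 0); intros n.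
- rewrite (harmonic_S (S n)).
  assert (h1 : 0 < INR (S n)) by (apply lt_0_INR; lia).
  assert (h2 : 0 < INR (S (S n))) by (apply lt_0_INR; lia).
  pose proof (ln_sub_ge _ _ h1 h2) as h.
  rewrite (S_INR (S n)) in h at 1.
  replace (INR (S n) + 1 - INR (S n)) with 1 in h by ring.
  unfold Rdiv in h; lra.
- pose proof (ln_le_harmonic (S n)).
  assert (ln (INR (S n)) <= ln (INR (S (S n)))); [| lra].
  apply ln_le; [apply lt_0_INR; lia | apply le_INR; lia].
Qed.

Definition psi (x : R) : R := psi_series x - euler_gamma.

(** Subtracting the sequence for [euler_gamma] from the partial sums of [psi_series] cancels the
    harmonic numbers. *)
Lemma is_lim_seq_psi (x : R) : 0 < x ->
  is_lim_seq (fun n => ln (INR (S n)) - sum_f_R0 (fun k => / (INR k + x)) n)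
    (psi x).
Proof.
intros hx.
apply is_lim_seq_ext with (fun n =>
  sum_f_R0 (fun k => / INR (S k) - / (INR k + x)) n
  - (harmonic (S n) - ln (INR (S n)))).
- intros n.
  assert (e : sum_f_R0 (fun k => / INR (S k) - / (INR k + x)) n
              = harmonic (S n) - sum_f_R0 (fun k => / (INR k + x)) n); [| lra].
  induction n as [| n IH].
  + rewrite harmonic_S, harmonic_0; simpl; ring.
  + rewrite !tech5, IH, (harmonic_S (S n)); ring.
- apply is_lim_seq_minus'; [| apply is_lim_seq_euler_gamma].
  apply is_lim_seq_ext with
    (sum_n (fun k => / INR (S k) - / (INR k + x)));
    [apply sum_n_Reals |].
  exact (Series_correct _ (ex_psi_series x hx)).
Qed.

(** * Slopes of ln Gamma *)

Lemma ln_Gamma_succ (x : R) : 0 < x ->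
  ln (Gamma (x + 1)) = ln x + ln (Gamma x).
Proof.
intros hx; rewrite Gamma_succ by easy; apply ln_mult; [easy |].
now apply Gamma_pos.
Qed.

Lemma ln_Gamma_shift (x : R) (n : nat) : 0 < x ->
  ln (Gamma (INR (S n) + x))
  = ln (Gamma x) + sum_f_R0 (fun k => ln (INR k + x)) n.
Proof.
intros hx; induction n as [| n IH].
- simpl; rewrite Rplus_comm, ln_Gamma_succ, Rplus_0_l by easy; ring.
- rewrite tech5, <- Rplus_assoc, <- IH.
  replace (INR (S (S n)) + x) with (INR (S n) + x + 1)
    by (rewrite (S_INR (S n)); ring).
  rewrite ln_Gamma_succ by now apply shift_pos.
  ring.
Qed.

Lemma ln_Gamma_wendel (x s : R) : 0 < x -> 0 <= s <= 1 ->
  ln (Gamma (x + s)) <= s * ln x + ln (Gamma x).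
Proof.
intros hx hs; pose proof (Gamma_wendel x s hx hs) as h.
assert (hg : 0 < Gamma (x + s)) by (apply Gamma_pos; lra).
pose proof (Gamma_pos x hx) as hg'.
pose proof (Rpower_pos x (1 - s)).
apply ln_le in h; [| now apply Rmult_lt_0_compat].
rewrite !ln_mult in h by easy.
unfold Rpower in h; rewrite ln_exp in h; lra.
Qed.

(** Tangent bounds for [ln], taken at either end of each step, turn the logarithms of the shift
    formula into the reciprocal sums defining [psi]. *)
Lemma sum_ln_bounds (x y : R) (n : nat) : 0 < x -> 0 < y ->
  (y - x) * sum_f_R0 (fun k => / (INR k + y)) n
    <= sum_f_R0 (fun k => ln (INR k + y)) n - sum_f_R0 (fun k => ln (INR k + x)) n
    <= (y - x) * sum_f_R0 (fun k => / (INR k + x)) n.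
Proof.
intros hx hy.
assert (h : forall k, (y - x) * / (INR k + y)
  <= ln (INR k + y) - ln (INR k + x) <= (y - x) * / (INR k + x)).
{ intros k; pose proof (shift_pos k x hx) as h1.
  pose proof (shift_pos k y hy) as h2.
  pose proof (ln_sub_le _ _ h1 h2) as h3; pose proof (ln_sub_ge _ _ h1 h2) as h4.
  replace (INR k + y - (INR k + x)) with (y - x) in * by ring.
  unfold Rdiv in *; lra. }
induction n as [| n IH]; [apply h |].
rewrite !tech5; specialize (h (S n)); lra.
Qed.

(** With [N = n + 1], shift both arguments by [N] and apply Wendel from [N + x] to [N + y].
    Replacing [ln (N + x)] by [ln N] costs the vanishing term [(y - x) x / N]. *)
Lemma ln_Gamma_slope_le (x y : R) : 0 < x -> x <= y <= x + 1 ->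
  ln (Gamma y) - ln (Gamma x) <= psi y * (y - x).
Proof.
intros hx hy; assert (hy0 : 0 < y) by lra.
assert (hlim : is_lim_seq (fun n =>
  (ln (INR (S n)) - sum_f_R0 (fun k => / (INR k + y)) n) * (y - x)
  + (y - x) * x * / (INR n + 1)) (psi y * (y - x) + (y - x) * x * 0)).
{ apply is_lim_seq_plus'.
  - apply is_lim_seq_mult'; [now apply is_lim_seq_psi | apply is_lim_seq_const].
  - apply is_lim_seq_mult'; [apply is_lim_seq_const | apply is_lim_seq_inv_shift]. }
rewrite Rmult_0_r, Rplus_0_r in hlim.
refine (is_lim_seq_le _ _ (ln (Gamma y) - ln (Gamma x)) _ _
  (is_lim_seq_const _) hlim); intros n.
pose proof (sum_ln_bounds x y n hx hy0) as [h _].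
pose proof (ln_Gamma_shift x n hx) as ex; pose proof (ln_Gamma_shift y n hy0) as ey.
pose proof (shift_pos (S n) x hx) as hX.
pose proof (ln_Gamma_wendel (INR (S n) + x) (y - x) hX ltac:(lra)) as hw.
replace (INR (S n) + x + (y - x)) with (INR (S n) + y) in hw by ring.
assert (hS : 0 < INR (S n)) by (apply lt_0_INR; lia).
pose proof (ln_sub_le _ _ hS hX) as hl.
replace (INR (S n) + x - INR (S n)) with x in hl by ring.
apply (Rmult_le_compat_l (y - x)) in hl; [| lra].
rewrite <- (S_INR n).
unfold Rdiv in hl; lra.
Qed.

(** Here Wendel goes from [N + y] up to [N + x + 1], a step of [1 - (y - x)], which bounds
    [Gamma (N + y)] from below. The error is [ln (N + y) - ln (N + x)], at most
    [(y - x) / (N + x)]. *)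
Lemma ln_Gamma_slope_ge (x y : R) : 0 < x -> x <= y <= x + 1 ->
  psi x * (y - x) <= ln (Gamma y) - ln (Gamma x).
Proof.
intros hx hy; assert (hy0 : 0 < y) by lra.
assert (hlim : is_lim_seq (fun n =>
  (ln (INR (S n)) - sum_f_R0 (fun k => / (INR k + x)) n) * (y - x)
  - (y - x) * / (INR n + (1 + x))) (psi x * (y - x) - (y - x) * 0)).
{ apply is_lim_seq_minus'.
  - apply is_lim_seq_mult'; [now apply is_lim_seq_psi | apply is_lim_seq_const].
  - apply is_lim_seq_mult'; [apply is_lim_seq_const | apply is_lim_seq_inv_shift]. }
rewrite Rmult_0_r, Rminus_0_r in hlim.
refine (is_lim_seq_le _ _ _ (ln (Gamma y) - ln (Gamma x)) _
  hlim (is_lim_seq_const _)); intros n.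
pose proof (sum_ln_bounds x y n hx hy0) as [_ h].
pose proof (ln_Gamma_shift x n hx) as ex; pose proof (ln_Gamma_shift y n hy0) as ey.
pose proof (shift_pos (S n) x hx) as hX.
pose proof (shift_pos (S n) y hy0) as hY.
pose proof (ln_Gamma_wendel (INR (S n) + y) (1 - (y - x)) hY ltac:(lra)) as hw.
replace (INR (S n) + y + (1 - (y - x))) with (INR (S n) + x + 1) in hw by ring.
rewrite ln_Gamma_succ in hw by easy.
assert (hS : 0 < INR (S n)) by (apply lt_0_INR; lia).
pose proof (ln_sub_le _ _ hX hY) as hl.
replace (INR (S n) + y - (INR (S n) + x)) with (y - x) in hl by ring.
assert (hS' : ln (INR (S n)) <= ln (INR (S n) + y)) by (apply ln_le; lra).
apply (Rmult_le_compat_l (y - x)) in hS'; [| lra].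
replace (INR n + (1 + x)) with (INR (S n) + x) by (rewrite S_INR; ring).
unfold Rdiv in hl; lra.
Qed.

Lemma is_derive_psi (x : R) : 0 < x ->
  is_derive psi x (shift_series (fun _ => 1) 2 x).
Proof.
intros hx; unfold psi.
rewrite <- (Rminus_0_r (shift_series _ _ _)).
apply (is_derive_minus psi_series (fun _ => euler_gamma)).
- now apply is_derive_psi_series.
- exact (is_derive_const euler_gamma x).
Qed.

Lemma is_derive_ln_Gamma (x : R) : 0 < x ->
  is_derive (fun y => ln (Gamma y)) x (psi x).
Proof.
intros hx; apply is_derive_Reals; intros eps heps.
assert (hc : continuous psi x).
{ apply continuous_of_ex_derive; eexists; now apply is_derive_psi. }
destruct (proj1 (filterlim_locally _ _) hc (mkposreal eps heps)) as [d hd].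
(* [d] serves continuity of [psi], [x] keeps [x + h] positive, and 1 is the range of the slope
   bounds. *)
assert (hr : 0 < Rmin d (Rmin x 1))
  by (apply Rmin_pos; [apply cond_pos | apply Rmin_pos; lra]).
exists (mkposreal _ hr); intros h h0 hh; simpl in hh.
pose proof (Rmin_l d (Rmin x 1)); pose proof (Rmin_r d (Rmin x 1)).
pose proof (Rmin_l x 1); pose proof (Rmin_r x 1).
assert (hP : psi x - eps < psi (x + h) < psi x + eps).
{ apply (ball_bounds (psi x) (psi (x + h)) eps), hd.
  change (Rabs (x + h - x) < d); replace (x + h - x) with h by ring; lra. }
apply Rabs_def2 in hh; set (Q := (ln (Gamma (x + h)) - ln (Gamma x)) / h).
assert (eQ : ln (Gamma (x + h)) - ln (Gamma x) = Q * h)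
  by (unfold Q; field; easy).
destruct (Rtotal_order h 0) as [hneg | [-> | hpos]]; [| easy |].
- pose proof (ln_Gamma_slope_le (x + h) x ltac:(lra) ltac:(lra)).
  pose proof (ln_Gamma_slope_ge (x + h) x ltac:(lra) ltac:(lra)).
  replace (x - (x + h)) with (- h) in * by ring.
  assert (Q <= psi x) by nra; assert (psi (x + h) <= Q) by nra.
  apply Rabs_def1; lra.
- pose proof (ln_Gamma_slope_le x (x + h) hx ltac:(lra)).
  pose proof (ln_Gamma_slope_ge x (x + h) hx ltac:(lra)).
  replace (x + h - x) with h in * by ring.
  assert (psi x <= Q) by nra; assert (Q <= psi (x + h)) by nra.
  apply Rabs_def1; lra.
Qed.

(** * Polygamma functions and the derivative of T *)

Lemma locally_pos (x : R) : 0 < x -> locally x (fun y => 0 < y).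
Proof.
intros hx; exists (mkposreal x hx); intros y hy.
apply ball_bounds in hy; simpl in hy; lra.
Qed.

Lemma digamma_eq_psi (x : R) : 0 < x -> digamma x = psi x.
Proof.
intros hx; unfold digamma; pose proof (Gamma_pos x hx) as hg.
assert (h : is_derive Gamma x (psi x * Gamma x)).
{ apply (is_derive_ext_loc (fun y => exp (ln (Gamma y)))).
  - eapply filter_imp; [| exact (locally_pos x hx)].
    intros y hy; apply exp_ln; now apply Gamma_pos.
  - rewrite <- (exp_ln (Gamma x)) at 1 by easy.
    apply (is_derive_comp exp (fun y => ln (Gamma y))).
    + apply is_derive_exp.
    + now apply is_derive_ln_Gamma. }
rewrite (is_derive_unique _ _ _ h); field; lra.
Qed.

(** For [n >= 1] this is the classical [(-1)^(n+1) n! zeta(n+1, x)], with [n = S j]. *)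
Definition polygamma_series (n : nat) (x : R) : R :=
  match n with
  | O => psi x
  | S j => (-1) ^ j * INR (fact (S j)) * shift_series (fun _ => 1) (j + 2) x
  end.

Lemma is_derive_polygamma_series (n : nat) (x : R) : 0 < x ->
  is_derive (polygamma_series n) x (polygamma_series (S n) x).
Proof.
intros hx; destruct n as [| j].
- simpl; replace (1 * 1 * shift_series (fun _ => 1) 2 x)
    with (shift_series (fun _ => 1) 2 x) by ring.
  now apply is_derive_psi.
- evar_last.
  + apply (is_derive_scal (shift_series (fun _ => 1) (j + 2)) x
             ((-1) ^ j * INR (fact (S j)))).
    apply is_derive_shift_series; [apply one_dominated | lia | easy].
  + unfold polygamma_series.
    replace (S (j + 2)) with (S j + 2)%nat by lia.
    rewrite (fact_simpl (S j)), mult_INR.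
    replace (j + 2)%nat with (S (S j)) by lia.
    simpl pow; ring.
Qed.

Lemma polygamma_eq_series (n : nat) (x : R) : 0 < x ->
  polygamma n x = polygamma_series n x.
Proof.
unfold polygamma; revert x; induction n as [| n IH]; intros x hx.
{ now apply digamma_eq_psi. }
simpl Derive_n; rewrite (Derive_ext_loc _ (polygamma_series n)).
- now apply is_derive_unique, is_derive_polygamma_series.
- eapply filter_imp; [exact IH | now apply locally_pos].
Qed.

Lemma is_derive_sum_f_R0 (f : nat -> R -> R) (d : nat -> R) (x : R) (n : nat) :
  (forall k, (k <= n)%nat -> is_derive (f k) x (d k)) ->
  is_derive (fun y => sum_f_R0 (fun k => f k y) n) x (sum_f_R0 d n).
Proof.
induction n as [| n IH]; intros h; [exact (h 0%nat ltac:(lia)) |].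
exact (is_derive_plus _ _ x _ _ (IH (fun k hk => h k ltac:(lia)))
         (h (S n) ltac:(lia))).
Qed.

(* Normalising by [k!] turns the Leibniz formula into a Cauchy product, whose
   derivative needs no Pascal identity. *)
Definition taylor_coeff (k : nat) (x : R) : R :=
  polygamma_series k x / INR (fact k).

(** The coefficient of order [n] in the square of the Taylor series of [psi] at [x]. *)
Definition cauchy_square (n : nat) (x : R) : R :=
  sum_f_R0 (fun k => taylor_coeff k x * taylor_coeff (n - k) x) n.

Lemma is_derive_taylor_coeff (k : nat) (x : R) : 0 < x ->
  is_derive (taylor_coeff k) x (INR (S k) * taylor_coeff (S k) x).
Proof.
intros hx.
apply (is_derive_ext (fun y => / INR (fact k) * polygamma_series k y));
  [intros; apply Rmult_comm |].
evar_last.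
- apply is_derive_scal; now apply is_derive_polygamma_series.
- unfold taylor_coeff; rewrite fact_simpl, mult_INR.
  field; split; [apply INR_fact_neq_0 | apply not_0_INR; lia].
Qed.

(** The product rule yields products of total order [n + 1]. Once the first sum is reindexed, [w k]
    carries the weights [k] and [n + 1 - k], which add up to [n + 1]. *)
Lemma is_derive_cauchy_square (n : nat) (x : R) : 0 < x ->
  is_derive (cauchy_square n) x (INR (S n) * cauchy_square (S n) x).
Proof.
intros hx; evar_last.
- apply (is_derive_sum_f_R0
    (fun k y => taylor_coeff k y * taylor_coeff (n - k) y)).
  intros k hk.
  apply (is_derive_mult (taylor_coeff k) (taylor_coeff (n - k)));
    [now apply is_derive_taylor_coeff | now apply is_derive_taylor_coeff |].
  intros; apply Rmult_comm.
- set (w := fun k => taylor_coeff k x * taylor_coeff (S n - k) x).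
  transitivity (sum_f_R0 (fun k => INR (S k) * w (S k)) n
    + sum_f_R0 (fun k => (INR (S n) - INR k) * w k) n).
  { rewrite <- sum_plus; apply sum_eq; intros k hk; unfold w.
    rewrite <- minus_INR by lia.
    replace (S n - S k)%nat with (n - k)%nat by lia.
    replace (S n - k)%nat with (S (n - k)) by lia.
    change (plus (mult ?a ?b) (mult ?c ?d)) with (a * b + c * d); ring. }
  (* Both sums extend to the range 0 to [n + 1], since the added terms have weight 0. *)
  transitivity (sum_f_R0 (fun k => INR k * w k) (S n)
    + sum_f_R0 (fun k => (INR (S n) - INR k) * w k) (S n)).
  { rewrite (decomp_sum (fun k => INR k * w k) (S n)) by lia.
    rewrite (tech5 (fun k => (INR (S n) - INR k) * w k)).
    simpl pred; simpl (INR 0); ring. }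
  rewrite <- sum_plus; unfold cauchy_square; rewrite scal_sum.
  apply sum_eq; intros k _; fold (w k); ring.
Qed.

(** Writing [p = S r] removes the truncated subtractions, and the factorials of the binomial
    coefficient normalise the two polygamma factors. *)
Lemma T_eq (r : nat) (x : R) : 0 < x ->
  T x (S r) = (-1) ^ r / (2 * INR (fact r)) *
    (polygamma_series (S r) x - 2 * euler_gamma * polygamma_series r x
     - INR (fact r) * cauchy_square r x).
Proof.
intros hx; unfold T, cauchy_square.
replace (S r - 1)%nat with r by lia.
rewrite scal_sum, !polygamma_eq_series by easy.
do 2 f_equal; apply sum_eq; intros k hk.
rewrite !polygamma_eq_series by easy.
unfold Binomial.C, taylor_coeff; field; split; apply INR_fact_neq_0.
Qed.

(** Differentiation carries the bracket for [r] to that for [r + 1], as [r! (r + 1) = (r + 1)!]; the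
    prefactors have ratio [- (r + 1)]. *)
Lemma is_derive_T (r : nat) (x : R) : 0 < x ->
  is_derive (fun y => T y (S r)) x (- INR (S r) * T x (S (S r))).
Proof.
intros hx.
apply (is_derive_ext_loc (fun y => (-1) ^ r / (2 * INR (fact r)) *
    (polygamma_series (S r) y - 2 * euler_gamma * polygamma_series r y
     - INR (fact r) * cauchy_square r y))).
{ eapply filter_imp; [| exact (locally_pos x hx)].
  intros y hy; symmetry; now apply T_eq. }
rewrite T_eq by easy; evar_last.
- apply is_derive_scal.
  apply (is_derive_minus
    (fun y => polygamma_series (S r) y - 2 * euler_gamma * polygamma_series r y)
    (fun y => INR (fact r) * cauchy_square r y)).
  + apply (is_derive_minus (polygamma_series (S r))
      (fun y => 2 * euler_gamma * polygamma_series r y)).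
    * now apply is_derive_polygamma_series.
    * apply is_derive_scal; now apply is_derive_polygamma_series.
  + apply is_derive_scal; now apply is_derive_cauchy_square.
- unfold minus, plus, opp; cbn -[INR fact polygamma_series pow].
  rewrite fact_simpl, mult_INR; simpl pow.
  field; split; [apply INR_fact_neq_0 | apply not_0_INR; lia].
Qed.

Lemma harmonic_series_eq_T (r : nat) (x : R) : 0 < x ->
  shift_series harmonic (S (S r)) x = T x (S (S r)).
Proof.
revert x; induction r as [| r IH]; intros x hx.
(* In [T x 2] the [euler_gamma] term turns [psi] back into [psi_series]. *)
- rewrite harmonic_series_2, T_eq by easy.
  unfold cauchy_square, taylor_coeff, polygamma_series, psi; simpl; field.
- assert (h1 := is_derive_shift_series harmonic (S (S r)) x
    harmonic_self_dominated ltac:(lia) hx).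
  assert (h2 := is_derive_T (S r) x hx).
  (* Multiplied by this factor, both sides are derivatives of functions equal near [x] by
     induction. *)
  apply Rmult_eq_reg_l with (- INR (S (S r))).
  + rewrite <- (is_derive_unique _ _ _ h1), <- (is_derive_unique _ _ _ h2).
    apply Derive_ext_loc.
    eapply filter_imp; [exact IH | now apply locally_pos].
  + apply Ropp_neq_0_compat, not_0_INR; lia.
Qed.

(** * Binomial expansion of the series *)

Lemma is_series_harmonic (p : nat) (t : R) : (2 <= p)%nat -> 0 < t ->
  is_series (fun i => harmonic (S i) / (INR (S i) + t) ^ p) (T t p).
Proof.
intros hp ht.
(* The term at [k = 0] vanishes because [harmonic 0] is 0, so starting at 1 leaves the sum
   unchanged. *)
apply (is_series_incr_1 (fun k => harmonic k / (INR k + t) ^ p)).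
rewrite harmonic_0; unfold plus, Rdiv at 2; simpl.
rewrite Rmult_0_l, Rplus_0_r.
destruct p as [| [| r]]; [lia | lia |].
rewrite <- harmonic_series_eq_T by easy; apply Series_correct.
apply ex_shift_series; [apply harmonic_self_dominated | easy | easy].
Qed.

Lemma is_series_sum_f_R0 (a : nat -> nat -> R) (l : nat -> R) (n : nat) :
  (forall j, (j <= n)%nat -> is_series (a j) (l j)) ->
  is_series (fun i => sum_f_R0 (fun j => a j i) n) (sum_f_R0 l n).
Proof.
induction n as [| n IH]; intros h; [exact (h 0%nat ltac:(lia)) |].
exact (is_series_plus _ _ _ _ (IH (fun j hj => h j ltac:(lia)))
         (h (S n) ltac:(lia))).
Qed.

Theorem corollary2 (m n q p : nat)
  (hm : (1 <= m)%nat) (hn : (1 <= n)%nat) (hmn : Nat.gcd m n = 1%nat)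
  (hq : (1 <= q)%nat) (hp : (q + 2 <= p)%nat) :
  is_series
    (fun i : nat =>
       let k := S i in
       INR k ^ q * harmonic k / (INR m * INR k + INR n) ^ p)
    (1 / INR m ^ p *
     sum_f_R0
       (fun j : nat =>
          (-1) ^ j * Binomial.C q j * (INR n / INR m) ^ j *
          T (INR n / INR m) (p - q + j)%nat)
       q).
Proof.
assert (hm0 : 0 < INR m) by (apply lt_0_INR; lia).
assert (hn0 : 0 < INR n) by (apply lt_0_INR; lia).
set (t := INR n / INR m).
assert (ht : 0 < t) by now apply Rdiv_lt_0_compat.
apply is_series_ext with (fun i => 1 / INR m ^ p * sum_f_R0 (fun j =>
  (-1) ^ j * Binomial.C q j * t ^ j
  * (harmonic (S i) / (INR (S i) + t) ^ (p - q + j))) q).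
- intros i; cbv zeta.
  pose proof (shift_pos (S i) t ht) as hk; set (k := INR (S i)) in *.
  replace (INR m * k + INR n) with (INR m * (k + t)) by (unfold t; field; lra).
  replace (k ^ q) with ((- t + (k + t)) ^ q) by (f_equal; ring).
  rewrite binomial, Rpow_mult_distr.
  assert (hmp : 0 < INR m ^ p) by now apply pow_lt.
  assert (hkp : 0 < (k + t) ^ p) by now apply pow_lt.
  set (b := sum_f_R0 _ q); set (d := sum_f_R0 _ q).
  assert (e : b = harmonic (S i) / (k + t) ^ p * d).
  { unfold b, d; rewrite scal_sum; apply sum_eq; intros j hj.
    (* The factor [(k + t)^(q - j)] of the binomial expansion cancels this part of the
       denominator. *)
    replace p with (p - q + j + (q - j))%nat at 2 by lia.
    rewrite !pow_add; replace (- t) with (-1 * t) by ring.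
    rewrite Rpow_mult_distr.
    field; repeat split; apply pow_nonzero; lra. }
  rewrite e; match goal with |- @eq _ ?u ?v => change (@eq R u v) end; field; lra.
- apply (is_series_scal_l (V := R_NormedModule) (K := R_AbsRing) (1 / INR m ^ p)).
  apply (is_series_sum_f_R0 (fun j i => (-1) ^ j * Binomial.C q j * t ^ j
    * (harmonic (S i) / (INR (S i) + t) ^ (p - q + j)))).
  intros j hj.
  apply (is_series_scal_l (V := R_NormedModule) (K := R_AbsRing)
    ((-1) ^ j * Binomial.C q j * t ^ j)).
  (* The bound [q + 2 <= p] makes each exponent [p - q + j] at least 2. *)
  apply is_series_harmonic; [lia | easy].
Qed.
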